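(* Fix an integer $n\ge 2$. Then, as the integer $k$ tends to infinity, $$\alpha\left(k,\frac{n}{n-1}\right)\ge k+1-n-\frac{n-1}{k}+O\left(\frac{1}{k^2}\right)$$ and $$\alpha\left(k,\left(\frac{n}{n-1}\right)^+\right)\ge k+2-n-\frac{n-1}{k}+O\left(\frac{1}{k^2}\right).$$ That is, there exist constants $C>0$ and $K$ (depending on $n$) such that for all integers $k\ge K$, $\alpha\left(k,\frac{n}{n-1}\right)\ge k+1-n-\frac{n-1}{k}-\frac{C}{k^2}$ and $\alpha\left(k,\left(\frac{n}{n-1}\right)^+\right)\ge k+2-n-\frac{n-1}{k}-\frac{C}{k^2}$.
   Context: A word of the form $w=xx\cdots xy$, where $x$ is a non-empty word and $y$ is a prefix of $x$ (possibly empty), is called a power of exponent $|w|/|x|$ and period $|x|$. For a real $\beta>1$, a word is $\beta$-free if it has no factor (contiguous subword) that is a power of exponent $\gamma$ with $\gamma\ge\beta$, and it is $\beta^+$-free if it has no factor that is a power of exponent $\gamma$ with $\gamma>\beta$. For a positive integer $k$, $\alpha(k,\beta)$ denotes the growth rate $\lim_{m\to\infty}|L_m|^{1/m}$, where $L_m$ is the set of $\beta$-free words of length $m$ over the alphabet $\{1,2,\ldots,k\}$; similarly $\alpha(k,\beta^+)$ is the growth rate of the set of $\beta^+$-free words over $\{1,\ldots,k\}$ (these limits exist since the languages are factorial). *)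

(* Defs.v *)
From HB Require Import structures.
From mathcomp Require Import all_boot all_order all_algebra.
From mathcomp Require Import all_classical all_reals all_analysis.
Import Order.TTheory GRing.Theory Num.Theory.
Import numFieldNormedType.Exports.

Set Implicit Arguments.
Unset Strict Implicit.
Unset Printing Implicit Defensive.

Local Open Scope classical_set_scope.
Local Open Scope ring_scope.

(* The word x occurs at least once, so the exponent is at least 1. *)
Definition is_power (R : realType) (T : eqType) (gamma : R) (w : seq T) : Prop :=
  exists (x y : seq T) (i : nat),
    [/\ x != [::], prefix y x, w = flatten (nseq i.+1 x) ++ y
      & gamma = (size w)%:R / (size x)%:R].

Definition beta_free (R : realType) (T : eqType) (beta : R) : set (seq T) :=
  [set w | ~ exists (u : seq T) (gamma : R),
       [/\ infix u w, is_power gamma u & beta <= gamma]].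

Definition beta_plus_free (R : realType) (T : eqType) (beta : R) : set (seq T) :=
  [set w | ~ exists (u : seq T) (gamma : R),
       [/\ infix u w, is_power gamma u & beta < gamma]].

Definition num_words (T : finType) (L : set (seq T)) (m : nat) : nat :=
  #|[pred w : m.-tuple T | `[< L (tval w) >]]|.

(* [lim] is total.  The limit exists for every factorial language, in
   particular for the two languages of [alpha] and [alpha_plus]. *)
Definition growth_rate (R : realType) (T : finType) (L : set (seq T)) : R :=
  lim ((fun m : nat => (num_words L m)%:R `^ (m%:R^-1) : R) @ \oo).

Definition alpha (R : realType) (k : nat) (beta : R) : R :=
  growth_rate R (beta_free beta : set (seq 'I_k)).

Definition alpha_plus (R : realType) (k : nat) (beta : R) : R :=
  growth_rate R (beta_plus_free beta : set (seq 'I_k)).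

(* Main.v *)
(** Let N m count the words of length m, and let a repetition of period p be
    forbidden as soon as its length is at least p + e(p).  If w is good and
    w a is not, then w a has a suffix of some period p and length p + e(p); its
    last e(p) letters are determined by p and the remaining prefix, which is
    good.  Hence
      k N(m) <= N(m+1) + sum_p N(m+1-e(p)),
    and induction gives N(m+1) >= x N(m) as soon as
    x + sum_p x^(1-e(p)) <= k.  With d = n - 1, e(p) - 1 is floor((p-1)/d) for
    n/(n-1) and floor(p/d) for (n/(n-1))^+.  The sum over p >= 1 is therefore
    d/(1 - 1/x) in the first case and one less in the second, as the term
    p = 0 is missing; d/(1 - 1/x) = d + d/x + O(1/x^2). *)

Require Import Defs.
From HB Require Import structures.
From mathcomp Require Import all_boot all_order all_algebra.
From mathcomp Require Import all_classical all_reals all_analysis.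
From mathcomp Require Import zify ring lra.
Import Order.TTheory GRing.Theory Num.Theory.
Import numFieldNormedType.Exports.

Set Implicit Arguments.
Unset Strict Implicit.
Unset Printing Implicit Defensive.

Local Open Scope ring_scope.

(** * Word counts and factorial languages *)

Definition factorial_language (T : eqType) (L : set (seq T)) : Prop :=
  forall u w, infix u w -> L w -> L u.

Definition words (T : finType) (L : set (seq T)) (m : nat) : seq (seq T) :=
  [seq tval w | w <- enum [pred w : m.-tuple T | `[< L (tval w) >]]].

(* In the notation of the header, [f p] is [e(p) - 1]. *)
Definition excess_free (T : eqType) (f : nat -> nat) : set (seq T) :=
  [set w | forall u p, infix u w -> (0 < p)%N -> prefix (drop p u) u ->
           (size u <= p + f p)%N].

(** Continuation with period [p]: iterating it rebuilds the tail of a repetition from the part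
    before it. *)
Definition extend (T : Type) (x0 : T) (p : nat) (w : seq T) : seq T :=
  rcons w (nth x0 w (size w - p)).

Lemma size_words (T : finType) (L : set (seq T)) m :
  size (words L m) = num_words L m.
Proof. by rewrite size_map -cardE. Qed.

Lemma words_uniq (T : finType) (L : set (seq T)) m : uniq (words L m).
Proof. by rewrite map_inj_uniq ?enum_uniq //; exact: val_inj. Qed.

Lemma mem_words (T : finType) (L : set (seq T)) m (w : seq T) :
  (w \in words L m) = (size w == m) && `[< L w >].
Proof.
apply/mapP/andP => [[t]|[wm Lw]].
  by rewrite mem_enum => Lt ->; rewrite size_tuple eqxx; split.
by exists (Tuple wm); [rewrite mem_enum|].
Qed.

Lemma num_words_sub (T : finType) (L M : set (seq T)) m :
  (L `<=` M)%classic -> (num_words L m <= num_words M m)%N.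
Proof.
move=> LM; rewrite -!size_words; apply: uniq_leq_size (words_uniq _ _) _ => w.
by rewrite !mem_words => /andP[-> /asboolP Lw]; apply/asboolP/LM.
Qed.

Lemma num_words_add (T : finType) (L : set (seq T)) a b :
  factorial_language L ->
  (num_words L (a + b) <= num_words L a * num_words L b)%N.
Proof.
move=> facL; rewrite -!size_words -(size_allpairs cat).
apply: uniq_leq_size (words_uniq _ _) _ => w.
rewrite mem_words => /andP[/eqP sw /asboolP Lw].
rewrite -(cat_take_drop a w); apply: allpairs_f; rewrite mem_words.
  rewrite size_takel ?sw ?leq_addr // eqxx; apply/asboolP/facL/Lw.
  exact: infix_take.
rewrite size_drop sw addKn eqxx; apply/asboolP/facL/Lw.
exact: infix_drop.
Qed.

(** * The recurrence for excess-free words *)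

Lemma excess_free_factorial (T : eqType) f :
  factorial_language (@excess_free T f).
Proof. by move=> u w uw fw v p vu; apply: fw; exact: infix_trans vu uw. Qed.

Lemma extend_take (T : eqType) (x0 : T) p j (s u : seq T) :
  (0 < p)%N -> prefix (drop p u) u -> (p + j <= size u)%N ->
  s ++ u = iter j (extend x0 p) (take (size (s ++ u) - j) (s ++ u)).
Proof.
move=> p0 /prefixP[u' uE] pj; set v := s ++ u.
have sv : size v = (size s + size u)%N by rewrite size_cat.
suff H i : (i <= j)%N ->
    iter i (extend x0 p) (take (size v - j) v) = take (size v - j + i) v.
  by rewrite H // subnK ?take_size // sv; lia.
elim: i => [|i IHi] ij; first by rewrite addn0.
rewrite iterS IHi ?(ltnW ij)// addnS (take_nth x0); last by rewrite sv; lia.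
rewrite /extend size_takel ?nth_take; try by rewrite sv; lia.
congr rcons.
(* The next letter sits at index [p + l] of [u], because at least [p] letters of [u] are kept; its
   copy one period earlier, at index [l], is therefore still in [u] and not in [s]. *)
have [l lu lE] : exists2 l, (p + l < size u)%N &
    (size v - j + i = size s + (p + l))%N.
  by exists (size v - j + i - size s - p)%N; rewrite sv; lia.
have -> : (size v - j + i - p = size s + l)%N by lia.
rewrite lE /v !nth_cat !ltnNge !leq_addr /= !addKn.
by rewrite -nth_drop {1}uE nth_cat size_drop ifT //; lia.
Qed.

(** A violating factor must end at the new letter, since otherwise it would already lie in [w]. Of
    its last [f p + 1] letters one is [a], so [w] itself loses only [f p]. *)
Lemma excess_free_rcons (T : eqType) (x0 : T) f (w : seq T) a :
  @excess_free T f w -> ~ @excess_free T f (rcons w a) ->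
  exists p, [/\ (0 < p)%N, (p + f p <= size w)%N &
    rcons w a = iter (f p).+1 (extend x0 p) (take (size w - f p) w)].
Proof.
move=> fw /existsNP[u /existsNP[p /not_implyP[uv]]].
move=> /not_implyP[p0 /not_implyP[pu]].
move/negP; rewrite -ltnNge => up.
have nuw : ~~ infix u w by apply/negP => uw; have := fw _ _ uw p0 pu; lia.
have [s [s' E]] := infixP uv.
case: (lastP s') E => [|s1 b].
  rewrite cats0 => E; exists p.
  have sz : (size w).+1 = (size s + size u)%N by rewrite -size_cat -E size_rcons.
  split=> //.
    rewrite -ltnS sz; lia.
  have := @extend_take T x0 p (f p).+1 s u p0 pu; rewrite -E => {1}->; last by lia.
  by rewrite size_rcons subSS -cats1 takel_cat // leq_subr.
rewrite -!rcons_cat => /rcons_inj[E _].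
by case/negP: nuw; rewrite E infix_infix.
Qed.

(** The filter [f p <= m] keeps out periods for which the truncated [m - f p] would count the empty
    word. *)
Lemma num_excess_free_recurrence (T : finType) f m :
  (#|T| * num_words (@excess_free T f) m <=
   num_words (@excess_free T f) m.+1 +
   \sum_(1 <= p < m.+2 | (f p <= m)%N)
     num_words (@excess_free T f) (m - f p))%N.
Proof.
set N := num_words _; case: (pickP T) => [x0 _|T0]; last by rewrite eq_card0.
set W := words (@excess_free T f).
pose bad p := [seq iter (f p).+1 (extend x0 p) w | w <- W (m - f p)%N].
pose l := [seq p <- index_iota 1 m.+2 | (f p <= m)%N].
pose s := W m.+1 ++ flatten [seq bad p | p <- l].
have <- : size s = (N m.+1 + \sum_(1 <= p < m.+2 | (f p <= m)%N) N (m - f p)%N)%N.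
  rewrite size_cat size_words size_flatten /shape sumnE !big_map big_filter.
  by congr addn; apply: eq_bigr => p _; rewrite size_map size_words.
rewrite mulnC cardE /N -size_words -(size_allpairs (@rcons T)).
apply: uniq_leq_size.
  apply: allpairs_uniq; [exact: words_uniq|exact: enum_uniq|].
  by move=> [w a] [w' a'] _ _ /= /rcons_inj.
move=> _ /allpairsP[[w a] /= [+ _ ->]].
rewrite mem_words => /andP[/eqP wm /asboolP fw].
rewrite mem_cat mem_words size_rcons wm eqxx /=.
case: asboolP => //= nfwa.
have [p [p0 pw ->]] := excess_free_rcons x0 fw nfwa.
apply/flattenP; exists (bad p).
  rewrite wm in pw; apply: map_f; rewrite mem_filter mem_index_iota p0 /=.
  by apply/andP; split; lia.
apply: map_f; rewrite mem_words size_takel ?leq_subr // wm eqxx /=.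
apply/asboolP/(excess_free_factorial _ fw); exact: infix_take.
Qed.

(** * From the recurrence to geometric growth *)

Lemma sum_expr_divn_le (R : realFieldType) (d M : nat) (y : R) :
  (0 < d)%N -> 0 <= y -> y < 1 ->
  \sum_(0 <= q < M) y ^+ (q %/ d) <= d%:R / (1 - y).
Proof.
move=> d0 y0 y1.
(* The quotient [q %/ d] is constant on blocks of length [d], so whole blocks form [d] times a
   geometric series; a general [M] is padded to [M * d]. *)
have blocks j : \sum_(0 <= q < j * d) y ^+ (q %/ d) <= d%:R / (1 - y).
  elim: j => [|j IHj].
    by rewrite mul0n big_nil divr_ge0 // subr_ge0 ltW.
  rewrite mulSn (big_cat_nat (n := d)) ?leq_addr //=.
  have -> : \sum_(0 <= q < d) y ^+ (q %/ d) = d%:R.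
    rewrite (eq_big_nat _ _ (F2 := fun=> 1)) ?sumr_const_nat ?subn0 // => q /andP[_ qd].
    by rewrite divn_small.
  have -> : \sum_(d <= q < d + j * d) y ^+ (q %/ d) =
            y * \sum_(0 <= q < j * d) y ^+ (q %/ d).
    rewrite -[X in index_iota X (d + _)]add0n big_addn addKn mulr_sumr.
    by apply: eq_bigr => q _; rewrite divnDr // divnn d0 addn1 exprS.
  have -> : d%:R / (1 - y) = d%:R + y * (d%:R / (1 - y)).
    by field; rewrite subr_eq0 gt_eqF.
  by rewrite lerD2l ler_wpM2l.
apply: le_trans (blocks M).
rewrite [leRHS](big_cat_nat (n := M)) ?leq_pmulr //= lerDl.
by apply: sumr_ge0 => q _; exact: exprn_ge0.
Qed.

Lemma num_excess_free_growth (R : realFieldType) (T : finType) f (x B : R) :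
  let N m : R := (num_words (@excess_free T f) m)%:R in
  0 < x -> (forall m, \sum_(1 <= p < m.+2) x^-1 ^+ f p <= B) ->
  x + B <= #|T|%:R -> forall m, x * N m <= N m.+1.
Proof.
move=> N x0 sumB xB; elim/ltn_ind => m IHm.
(* The induction hypothesis, iterated downwards, compares every shorter count with [N m]. *)
have back j : (j <= m)%N -> N (m - j)%N <= N m * x^-1 ^+ j.
  elim: j => [|j IHj] jm; first by rewrite subn0 expr0 mulr1.
  rewrite exprSr mulrA ler_pdivlMr // mulrC.
  apply: le_trans (IHj (ltnW jm)).
  have -> : (m - j = (m - j.+1).+1)%N by lia.
  by apply: IHm; lia.
have rec : #|T|%:R * N m <=
    N m.+1 + \sum_(1 <= p < m.+2 | (f p <= m)%N) N (m - f p)%N.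
  by rewrite -natrM -natr_sum -natrD ler_nat num_excess_free_recurrence.
have : \sum_(1 <= p < m.+2 | (f p <= m)%N) N (m - f p)%N <= N m * B.
  apply: (@le_trans _ _ (\sum_(1 <= p < m.+2 | (f p <= m)%N) N m * x^-1 ^+ f p)).
    by apply: ler_sum => p pm; exact: back.
  rewrite -mulr_sumr; apply: ler_wpM2l; first exact: ler0n.
  apply: le_trans (sumB m); rewrite [leRHS](bigID (fun p => (f p <= m)%N)) /=.
  rewrite lerDl; apply: sumr_ge0 => p _; rewrite exprn_ge0 // invr_ge0; exact: ltW.
have : (x + B) * N m <= #|T|%:R * N m by rewrite ler_wpM2r // ler0n.
lra.
Qed.

(** * Fekete's lemma and the growth rate *)

Lemma subadditive_cvg (R : realType) (u : nat -> R) :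
  (forall a b, u (a + b)%N <= u a + u b) -> (forall m, 0 <= u m) ->
  cvgn (fun m => u m / m%:R).
Proof.
move=> subu u0.
(* Index 0 is left out: division by zero gives 0 there, which would force the infimum to be 0. *)
pose E := [set u m.+1 / m.+1%:R | m in [set: nat]]%classic.
have E0 : lbound E 0 by move=> _ [m _ <-]; rewrite divr_ge0.
have infE : has_inf E by split; [exists (u 1%N / 1%:R), 0%N|exists 0].
suff : (u m / m%:R @[m --> \oo] --> inf E)%classic by move/cvgP.
apply/cvgrPdist_le => e e0.
have e20 : 0 < e / 2 by rewrite divr_gt0.
have [_ [q _ <-] qe] := inf_adherent e20 infE.
(* Euclidean division of [m] by [q'] gives [u m / m <= u q' / q' + M / m], where [M] bounds [u] at
   every remainder; each of the two errors takes half of [e]. *)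
set q' := q.+1 in qe *; pose M := \sum_(r < q') u r.
have umul a r : u (a * q' + r)%N <= a%:R * u q' + u r.
  elim: a => [|a IHa]; first by rewrite mul0n mul0r !add0r.
  rewrite mulSn -addnA; apply: le_trans (subu _ _) _.
  by rewrite -natr1; lra.
near=> m.
have m0 : 0 < m%:R :> R.
  by rewrite ltr0n; near: m; exact: nbhs_infty_gt.
have mM : M / (e / 2) < m%:R by near: m; exact: nbhs_infty_gtr.
have infm : inf E <= u m / m%:R.
  apply: ge_inf; first by exists 0.
  by exists m.-1 => //; rewrite prednK // -(ltr0n R).
rewrite ler0_norm ?subr_le0 // opprB lerBlDr.
have uM : u (m %% q')%N <= M.
  rewrite /M (bigD1 (Ordinal (ltn_pmod m (ltn0Sn q)))) //= lerDl.
  exact: sumr_ge0.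
have um : u m <= (m %/ q')%:R * u q' + M.
  by rewrite {1}(divn_eq m q'); apply: le_trans (umul _ _) _; rewrite lerD2l.
have q'0 : 0 < q'%:R :> R by rewrite ltr0n.
have : (m %/ q')%:R * u q' <= m%:R * (u q' / q'%:R).
  rewrite mulrCA mulrC ler_wpM2l // ler_pdivlMr // -natrM ler_nat.
  exact: leq_trunc_div.
have : m%:R * (u q' / q'%:R) <= m%:R * (inf E + e / 2).
  by rewrite ler_pM2l // ltW.
have : M <= m%:R * (e / 2) by rewrite -ler_pdivrMr // ltW.
rewrite ler_pdivrMr //; lra.
Unshelve. all: by end_near. Qed.

(** As [lim] is total, a termwise bound says nothing before convergence is known. That comes from
    Fekete's lemma applied to the logarithm of the counts. *)
Lemma growth_rate_ge (R : realType) (T : finType) (L : set (seq T)) (x : R) :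
  factorial_language L -> 0 < x ->
  (forall m, x ^+ m <= (num_words L m)%:R) -> x <= growth_rate R L.
Proof.
move=> facL x0 xL.
have L0 m : 0 < (num_words L m)%:R :> R.
  by apply: lt_le_trans (xL m); rewrite exprn_gt0.
pose u m : R := ln (num_words L m)%:R.
have cu : cvgn (fun m => u m / m%:R).
  apply: subadditive_cvg => [a b|m]; last first.
    by rewrite ln_ge0 // ler1n -(ltr0n R).
  by rewrite -lnM ?posrE // ler_ln ?posrE ?mulr_gt0 // -natrM ler_nat num_words_add.
rewrite /growth_rate; apply: limr_ge.
  have -> : (fun m => (num_words L m)%:R `^ m%:R^-1) =
            expR \o (fun m => u m / m%:R).
    by apply/funext => m; rewrite /powR gt_eqF //= mulrC.
  apply: cvgP; apply: continuous_cvg cu; exact: continuous_expR.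
near=> m.
have m0 : (0 < m)%N by near: m; exact: nbhs_infty_gt.
have -> : x = (x ^+ m) `^ m%:R^-1.
  by rewrite -powR_mulrn ?ltW // -powRrM divff ?powRr1 ?ltW // pnatr_eq0 -lt0n.
apply: ge0_ler_powR; rewrite ?nnegrE ?invr_ge0 ?ler0n //.
by rewrite exprn_ge0 // ltW.
Unshelve. all: by end_near. Qed.

(** * Powers as words with a period *)

Lemma is_power_period (R : realType) (T : eqType) (g : R) (u : seq T) :
  is_power g u ->
  exists p, [/\ (0 < p)%N, (p <= size u)%N, prefix (drop p u) u
              & g = (size u)%:R / p%:R].
Proof.
move=> [x [y [i [x0 /prefixP[z xE] uE gE]]]]; exists (size x); split => //.
- by rewrite lt0n size_eq0.
- by rewrite uE /= -catA size_cat leq_addr.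
rewrite uE /= -catA drop_size_cat //.
(* The word [x] commutes with its own powers. *)
have -> : x ++ flatten (nseq i x) ++ y = flatten (nseq i x) ++ x ++ y.
  by rewrite !catA; congr (_ ++ y); elim: i {uE} => [|i IHi] /=;
     rewrite ?cats0 // -catA -IHi.
by rewrite {3}xE -!catA catA prefix_prefix.
Qed.

Lemma beta_free_factorial (R : realType) (T : eqType) (b : R) :
  factorial_language (beta_free b : set (seq T)).
Proof.
move=> u w uw fw [v [g [vu gv bg]]]; apply: fw; exists v, g; split => //.
exact: infix_trans vu uw.
Qed.

Lemma beta_plus_free_factorial (R : realType) (T : eqType) (b : R) :
  factorial_language (beta_plus_free b : set (seq T)).
Proof.
move=> u w uw fw [v [g [vu gv bg]]]; apply: fw; exists v, g; split => //.
exact: infix_trans vu uw.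
Qed.

(** With excess [e = size u - p], exponent at least [(d + 1) / d] means [p <= d * e], so the largest
    harmless excess is [(p - 1) %/ d]. In the strict version below, [p < d * e] makes it
    [p %/ d]. *)
Lemma excess_free_beta_free (R : realType) (T : eqType) d : (0 < d)%N ->
  (excess_free (fun p => p.-1 %/ d)%N `<=`
     (beta_free (d.+1%:R / d%:R : R) : set (seq T)))%classic.
Proof.
move=> d0 w fw [u [g [uw /is_power_period[p [p0 pu per ->]]]]].
rewrite ler_pdivrMr ?ltr0n // mulrAC ler_pdivlMr ?ltr0n // -!natrM ler_nat => le.
have := fw u p uw p0 per; rewrite -leq_subLR leqNgt ltn_divLR //.
by rewrite mulnBl; lia.
Qed.

Lemma excess_free_beta_plus_free (R : realType) (T : eqType) d : (0 < d)%N ->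
  (excess_free (fun p => p %/ d)%N `<=`
     (beta_plus_free (d.+1%:R / d%:R : R) : set (seq T)))%classic.
Proof.
move=> d0 w fw [u [g [uw /is_power_period[p [p0 pu per ->]]]]].
rewrite ltr_pdivrMr ?ltr0n // mulrAC ltr_pdivlMr ?ltr0n // -!natrM ltr_nat => lt.
have := fw u p uw p0 per; rewrite -leq_subLR leqNgt ltn_divLR //.
by rewrite mulnBl; lia.
Qed.

Lemma growth_rate_excess_free (R : realType) (T : finType) (L : set (seq T))
    f (x B : R) :
  factorial_language L -> (excess_free f `<=` L)%classic -> 0 < x ->
  (forall m, \sum_(1 <= p < m.+2) x^-1 ^+ f p <= B) ->
  x + B <= #|T|%:R -> x <= growth_rate R L.
Proof.
move=> facL fL x0 sumB xB; apply: growth_rate_ge => // m.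
apply: (@le_trans _ _ (num_words (@excess_free T f) m)%:R); last first.
  by rewrite ler_nat num_words_sub.
elim: m => [|m IHm].
  rewrite expr0 ler1n -size_words -has_predT; apply/hasP; exists [::] => //.
  by rewrite mem_words; apply/asboolP => u p; rewrite infixs0 => /eqP ->.
rewrite exprS; apply: le_trans (num_excess_free_growth x0 sumB xB m).
by rewrite ler_wpM2l // ltW.
Qed.

(** * Asymptotics for a large alphabet *)

Lemma large_alphabet_estimate (R : realFieldType) (d k : R) :
  let C := 2 * d * (d + 2) in let x := k - d - d / k - C / k ^+ 2 in
  1 <= d -> 2 * d + 2 * C + 4 <= k -> 1 < x /\ d / (1 - x^-1) <= k - x.
Proof.
move=> C x d1 kK.
(* The bound on [k] makes both corrections at most 1/2 and [x - 1] at least [k / 2]; [C] is chosen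
   so that [C * (k / 2) = d * k * (d + 2)]. *)
have C0 : 0 <= C by rewrite /C; nra.
have k0 : 0 < k by lra.
have dk : d / k <= 1 / 2 by rewrite ler_pdivrMr //; lra.
have Ck : C / k ^+ 2 <= 1 / 2.
  by rewrite ler_pdivrMr ?exprn_gt0 // expr2; nra.
have xk : k / 2 <= x - 1 by rewrite /x; lra.
have x1 : 1 < x by lra.
split=> //.
have -> : d / (1 - x^-1) = d + d / (x - 1) by field; lra.
suff : d / (x - 1) <= d / k + C / k ^+ 2 by rewrite /x; lra.
have -> : d / k + C / k ^+ 2 = (d * k + C) / k ^+ 2 by field; lra.
rewrite ler_pdivrMr; last by lra.
rewrite mulrAC ler_pdivlMr ?exprn_gt0 //.
(* The difference is [C * (x - 1) - d * k * (k - x + 1)], and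
   [k - x + 1 <= d + 2]. *)
have : d * k * (k - x + 1) <= d * k * (d + 2).
  by apply: ler_wpM2l; [nra|rewrite /x; lra].
have : C * (k / 2) <= C * (x - 1) by exact: ler_wpM2l.
rewrite {1}/C; nra.
Qed.

Theorem theorem1 (R : realType) (n : nat) (hn : (2 <= n)%N) :
  exists (C : R) (K : nat), 0 < C /\
    forall k : nat, (K <= k)%N ->
      k%:R + 1 - n%:R - (n%:R - 1) / k%:R - C / k%:R ^+ 2
        <= alpha k (n%:R / (n%:R - 1) : R)
      /\
      k%:R + 2 - n%:R - (n%:R - 1) / k%:R - C / k%:R ^+ 2
        <= alpha_plus k (n%:R / (n%:R - 1) : R).
Proof.
have [d nE d0] : exists2 d, n = d.+1 & (0 < d)%N by exists n.-1; lia.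
rewrite {}nE {n hn}.
have -> : d.+1%:R - 1 = d%:R :> R by rewrite -natr1 addrK.
have d1 : 1 <= d%:R :> R by rewrite ler1n.
exists (2 * d%:R * (d%:R + 2)), (2 * d + 2 * (2 * d * (d + 2)) + 4)%N.
split; first by nra.
move=> k kK; set C : R := 2 * _ * _.
have [] := @large_alphabet_estimate R d%:R k%:R d1.
  by rewrite -!natrM -!natrD -!natrM -!natrD ler_nat.
rewrite -/C; set x : R := _ - _ => x1 xB.
have x0 : 0 < x by apply: lt_trans x1.
have y0 : 0 <= x^-1 by rewrite invr_ge0 ltW.
have y1 : x^-1 < 1 by rewrite invf_lt1.
have sumle M := sum_expr_divn_le M d0 y0 y1.
split.
  have -> : k%:R + 1 - d.+1%:R - d%:R / k%:R - C / k%:R ^+ 2 = x.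
    by rewrite /x -natr1; lra.
  rewrite /alpha.
  apply: (growth_rate_excess_free (@beta_free_factorial R _ _)
    (@excess_free_beta_free R _ d d0) x0 (B := d%:R / (1 - x^-1))).
    (* Shifting the index turns [p.-1 %/ d] into [q %/ d] with [q] starting at 0. *)
    by move=> m; rewrite big_add1 /=; exact: sumle.
  by rewrite card_ord; lra.
(* The rate gains 1 and the sum, lacking its term 1 at [p = 0], loses 1, so the estimate for [x]
   serves again. *)
have -> : k%:R + 2 - d.+1%:R - d%:R / k%:R - C / k%:R ^+ 2 = x + 1.
  by rewrite /x -natr1; lra.
have z0 : 0 < x + 1 by lra.
have zx : (x + 1)^-1 <= x^-1 by rewrite lef_pV2 ?posrE //; lra.
have zB : d%:R / (1 - (x + 1)^-1) <= d%:R / (1 - x^-1) :> R.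
  by rewrite ler_wpM2l // lef_pV2 ?posrE; lra.
rewrite /alpha_plus.
apply: (growth_rate_excess_free (@beta_plus_free_factorial R _ _)
  (@excess_free_beta_plus_free R _ d d0) z0 (B := d%:R / (1 - x^-1) - 1)).
  move=> m; rewrite lerBrDr addrC.
  have := sum_expr_divn_le m.+2 d0 (_ : 0 <= (x + 1)^-1) (_ : (x + 1)^-1 < 1).
  rewrite big_ltn // div0n expr0 => H; apply: le_trans zB; apply: H.
    by rewrite invr_ge0 ltW.
  exact: le_lt_trans zx y1.
by rewrite card_ord; lra.
Qed.
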